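(* Let $\kappa>0$, let $P_T=\{x_j\}_{j=1}^{N_T}$ and $P_S=\{y_k\}_{k=1}^{N_S}$ be finite sets of points in $\mathbb{R}^3$ contained in axis-parallel boxes $T$ and $S$, respectively, let $N=\max\{N_T,N_S\}$, and let $\mathcal{T}_T$, $\mathcal{T}_S$ be the corresponding uniform box cluster trees with parameter $n_{\max}$. Let $p_{\min}$ and $p_{\max}$ be the minimum and maximum of their depths. Let $\mathcal{T}_{T\times S}$ be the block tree with parameter $\eta_2>0$. Assume that the root boxes $T$ and $S$ are identical up to translation, and let $q_0$ be their common diameter. Then the number $N_{\mathrm{SC}}$ of coupling matrices $A_{c,t\times s}$ which have to be stored can be estimated by $$N_{\mathrm{SC}}\le p_{\min}\max\left\{c_{\mathrm{C}},\,c_{\mathrm{C}}^{2/3}(\kappa q_0)^2\right\},$$ where $c_{\mathrm{C}}$ is the same constant as in the bound $N_{\mathrm{C}}\le c_{\mathrm{C}}(p_{\min}(\kappa q_0)^3+8^{p_{\min}})$ for the number $N_{\mathrm{C}}$ of all coupling matrices (see context). If $p_{\max}\le\log_8(N)+c_{\mathrm{ad}}$ and $\kappa q_0\le c_{\mathrm{geo}}\sqrt[3]{N}$ hold for constants $c_{\mathrm{ad}},c_{\mathrm{geo}}\in\mathbb{R}_+$, the corresponding storage complexity is $\mathcal{O}(N^{2/3}\log(N))$.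
   Context: **Uniform box cluster tree.** Given a finite set of points in an axis-parallel half-open box $T=(a_1,b_1]\times(a_2,b_2]\times(a_3,b_3]$ and $n_{\max}\in\mathbb{N}$, the tree $\mathcal{T}_T$ has root $T$ (level 0). Recursively, a box containing more than $n_{\max}$ of the points is subdivided at its center into 8 congruent half-open boxes, and those of the 8 boxes containing at least one point become its children. A box with at most $n_{\max}$ points is a leaf. $\mathcal{L}_T$ is the set of leaves and $p(\mathcal{T}_T)$ the depth (maximal level). Analogously for $S$. The midpoint of a box $t$ is denoted by $m_t$. **Block tree.** Let $\operatorname{diam}(t)=\sup_{x_1,x_2\in t}|x_1-x_2|$, $\operatorname{dist}(t,s)=\inf_{x\in t,y\in s}|x-y|$. Consider for a pair $(t,s)$ the criteria (A1) $\max\{\operatorname{diam}(t),\operatorname{diam}(s)\}\le\eta_2\operatorname{dist}(t,s)$, (A3) $\kappa\max\{\operatorname{diam}(t),\operatorname{diam}(s)\}^2\le\eta_2\operatorname{dist}(t,s)$. The block tree $\mathcal{T}_{T\times S}$ has root $(T,S)$. A block $(t,s)$ is a leaf of it if $t\in\mathcal{L}_T$ or $s\in\mathcal{L}_S$ or if (A1) and (A3) both hold. Otherwise its children are all $(t',s')$ with $t'$ a child of $t$ and $s'$ a child of $s$. In particular both boxes of a block have the same level. $\mathcal{L}_{T\times S}^+$ is the set of leaves $(t,s)$ of $\mathcal{T}_{T\times S}$ satisfying (A1) and (A3). **Coupling matrices.** Let $m$ be a fixed interpolation degree. To each block $(t,s)\in\mathcal{L}_{T\times S}^+$ at level $\ell$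 a direction $c\in\mathbb{R}^3$ ($|c|=1$ or $c=0$) is assigned which is a function of $\ell$ and $(m_t-m_s)/|m_t-m_s|$ only, and one coupling matrix $A_{c,t\times s}\in\mathbb{C}^{(m+1)^3\times(m+1)^3}$ is used for this block. Its entries are $f_c(\xi_{t,\alpha},\xi_{s,\beta})$, where $\xi_{t,\alpha},\xi_{s,\beta}$ ($\alpha,\beta\in\{1,\dots,m+1\}^3$) are the tensor Chebyshev nodes of order $m+1$ transformed to $t$ and $s$, and $f_c(x,y)=\exp(i\kappa(|x-y|-\langle x-y,c\rangle))/(4\pi|x-y|)$. The number of all coupling matrices is $N_{\mathrm{C}}=\#\mathcal{L}_{T\times S}^+$. **The constant $c_{\mathrm{C}}$.** It is the constant, depending only on $c_{\mathrm{un}}$ and $\eta_2$, of the estimate $N_{\mathrm{C}}\le c_{\mathrm{C}}(p_{\min}(\kappa q_0)^3+8^{p_{\min}})$, which is established when the larger root diameter $q_0$ is at most $c_{\mathrm{un}}$ times the smaller one; for root boxes identical up to translation one can take $c_{\mathrm{un}}=1$. **Stored coupling matrices.** Blocks at the same level with the same difference of midpoints have the same coupling matrix, which is stored only once. Thus $N_{\mathrm{SC}}$ is the number of distinct pairs $(\operatorname{level}(t),\,m_t-m_s)$ with $(t,s)\in\mathcal{L}_{T\times S}^+$. The corresponding storage is the total number of entries of these $N_{\mathrm{SC}}$ matrices. In the $\mathcal{O}$-statement, $m$, $\eta_2$ and the constants in the assumptions are regarded as fixed.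
   Formalization: c_C may also depend on a bound for the side ratios of the root boxes (for very flat boxes no constant depending only on c_un and η₂ exists), and the N_SC estimate excludes p_min = 0 with (T,S) admissible, where N_SC = 1 but the right-hand side is 0; the O-statement needs neither. *)

(* Defs.v *)
From HB Require Import structures.
From mathcomp Require Import all_boot all_order all_algebra finmap.
From mathcomp Require Import all_classical all_reals all_analysis.

Set Implicit Arguments.
Unset Strict Implicit.
Unset Printing Implicit Defensive.

Import Order.TTheory GRing.Theory Num.Theory.

Local Open Scope classical_set_scope.
Local Open Scope ring_scope.

Section Boxes.
Variable R : realType.

(* The library norm `|x| on row vectors is the maximum norm. *)
Definition enorm (x : 'rV[R]_3) : R := Num.sqrt (\sum_i x ord0 i ^+ 2).

(* A box is given by its corners (a, b) and stands for the product of the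
   intervals ]a_i, b_i]. *)
Definition box : Type := ('rV[R]_3 * 'rV[R]_3)%type.
Implicit Types t s : box.

Definition proper_box t : Prop := forall i, t.1 ord0 i < t.2 ord0 i.

Definition in_box t (x : 'rV[R]_3) : bool :=
  [forall i, t.1 ord0 i < x ord0 i <= t.2 ord0 i].

Definition box_set t : set 'rV[R]_3 := [set x | in_box t x].

Definition midpoint t : 'rV[R]_3 := 2^-1 *: (t.1 + t.2).

Definition diam t : R :=
  sup [set enorm (x - y) | x in box_set t & y in box_set t].

Definition dist t s : R :=
  inf [set enorm (x - y) | x in box_set t & y in box_set s].

(* e i selects the lower (false) or upper (true) half in direction i. *)
Definition octant t (e : {ffun 'I_3 -> bool}) : box :=
  (\row_i (if e i then midpoint t ord0 i else t.1 ord0 i),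
   \row_i (if e i then t.2 ord0 i else midpoint t ord0 i)).

Definition translates t s : Prop :=
  exists v : 'rV[R]_3, s = (t.1 + v, t.2 + v).

Definition aspect_ratio_le (rho : R) t : Prop :=
  forall i j, t.2 ord0 i - t.1 ord0 i <= rho * (t.2 ord0 j - t.1 ord0 j).

End Boxes.

Section ClusterTree.
Variables (R : realType) (P : {fset 'rV[R]_3}) (nmax : nat).
Implicit Types t : box R.

Definition npoints t : nat := #|` [fset x in P | in_box t x] |%fset.

Definition cluster_leaf t : Prop := (npoints t <= nmax)%N.

Definition child t t' : Prop :=
  ~ cluster_leaf t /\
  exists e, t' = octant t e /\ (0 < npoints t')%N.

Variable T : box R.

Inductive cluster : nat -> box R -> Prop :=
| cluster_root : cluster 0 T
| cluster_child l t t' : cluster l t -> child t t' -> cluster l.+1 t'.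

(* fset_set sends an infinite set to the empty one; for nmax > 0 and a proper
   box T there are finitely many levels, because P is finite, and hence also
   finitely many blocks below. *)
Definition depth : nat :=
  \max_(l <- fset_set [set l | exists t, cluster l t]) l.

End ClusterTree.

Record setting (R : realType) := Setting {
  kappa : R;
  nmax : nat;
  PT : {fset 'rV[R]_3};
  PS : {fset 'rV[R]_3};
  boxT : box R;
  boxS : box R;
  kappa_gt0 : 0 < kappa;
  nmax_gt0 : (0 < nmax)%N;
  boxT_proper : proper_box boxT;
  boxS_proper : proper_box boxS;
  PT_in_boxT : forall x, x \in PT -> in_box boxT x;
  PS_in_boxS : forall x, x \in PS -> in_box boxS x
}.

Section BlockTree.
Variables (R : realType) (eta2 : R) (g : setting R).
Implicit Types t s : box R.

Definition npts : nat := maxn #|` PT g|%fset #|` PS g|%fset.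

Definition pT : nat := depth (PT g) (nmax g) (boxT g).
Definition pS : nat := depth (PS g) (nmax g) (boxS g).
Definition pmin : nat := minn pT pS.
Definition pmax : nat := maxn pT pS.

Definition q0 : R := Num.max (diam (boxT g)) (diam (boxS g)).

Definition critA1 t s : Prop :=
  Num.max (diam t) (diam s) <= eta2 * dist t s.

Definition critA3 t s : Prop :=
  kappa g * Num.max (diam t) (diam s) ^+ 2 <= eta2 * dist t s.

Definition admissible t s : Prop := critA1 t s /\ critA3 t s.

Definition block_leaf t s : Prop :=
  [\/ cluster_leaf (PT g) (nmax g) t, cluster_leaf (PS g) (nmax g) s
    | admissible t s].

Inductive block : nat -> box R -> box R -> Prop :=
| block_root : block 0 (boxT g) (boxS g)
| block_child l t s t' s' :
    block l t s -> ~ block_leaf t s ->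
    child (PT g) (nmax g) t t' -> child (PS g) (nmax g) s s' ->
    block l.+1 t' s'.

Definition Lplus : set (nat * (box R * box R)) :=
  [set b | [/\ block b.1 b.2.1 b.2.2, block_leaf b.2.1 b.2.2
             & admissible b.2.1 b.2.2]].

Definition N_C : nat := #|` fset_set Lplus|%fset.

(* The coupling matrix of a block (t, s) has the entries
   f_c(xi_{t,alpha}, xi_{s,beta}), where f_c(x, y) is a function of x - y, the
   xi are the tensor Chebyshev nodes transformed to t and s, and c depends only
   on the level and on the direction of m_t - m_s.  For root boxes identical up
   to translation it is therefore determined by the level and m_t - m_s, and it
   is stored once for each value of this key. *)
Definition coupling_key (b : nat * (box R * box R)) : nat * 'rV[R]_3 :=
  (b.1, midpoint b.2.1 - midpoint b.2.2).

Definition N_SC : nat := #|` fset_set (coupling_key @` Lplus)|%fset.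

(* For interpolation degree m, the (m+1)^3 tensor nodes in each of the two boxes
   index the rows and the columns of a coupling matrix. *)
Definition storage (m : nat) : nat := (N_SC * (m.+1 ^ 3 * m.+1 ^ 3))%N.

End BlockTree.

(* Main.v *)
Require Import Defs.
From HB Require Import structures.
From mathcomp Require Import all_boot all_order all_algebra finmap.
From mathcomp Require Import all_classical all_reals all_analysis.
From mathcomp Require Import zify ring lra.


(* At level l all clusters lie on a uniform grid, so for root boxes identical up
   to translation m_t - m_s takes at most (2 * 2 ^ l) ^ 3 values.  On the other
   hand the parent of a block is not admissible, so with x = kappa * q0 its boxes
   are at distance at most a constant times (q0 / 2 ^ l) * (1 + x / 2 ^ l); this
   leaves at most K * (1 + x / 2 ^ l) grid coordinates in each direction.  Hence
   level l contributes at most min(8 * 8 ^ l, K ^ 3 * (1 + x / 2 ^ l) ^ 3) keys,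
   which is at most 8 * K ^ 3 * max(1, x ^ 2), and at most
   8 ^ l * K ^ 3 * (1 + x / 2 ^ l) ^ 3 blocks.  The storage estimate assumes no
   bound on the aspect ratio; the distance restriction is then used in the longest
   direction only, giving a constant times 4 ^ l + x * 2 ^ l keys on level l, which
   is O(N ^ (2 / 3)). *)

Import Order.TTheory GRing.Theory Num.Theory.
Local Open Scope classical_set_scope.
Local Open Scope ring_scope.

(** * Euclidean norm, boxes and the dyadic grid *)

Section Geometry.
Context {R : realType}.
Implicit Types (t s T : box R) (x y : 'rV[R]_3) (i : 'I_3) (l : nat).

Lemma enorm_ge_coord x i : `|x ord0 i| <= enorm x.
Proof.
rewrite -sqrtr_sqr ler_wsqrtr // (bigD1 i) //= lerDl.
by apply: sumr_ge0 => j _; exact: sqr_ge0.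
Qed.

Lemma enorm_le x y :
  (forall i, `|x ord0 i| <= `|y ord0 i|) -> enorm x <= enorm y.
Proof.
move=> xy; rewrite ler_wsqrtr // ler_sum // => i _.
by rewrite -real_normK ?num_real // -[leRHS]real_normK ?num_real // lerXn2r ?nnegrE.
Qed.

Lemma enormZ (c : R) x : 0 <= c -> enorm (c *: x) = c * enorm x.
Proof.
move=> c0; rewrite /enorm.
under eq_bigr do rewrite mxE exprMn.
by rewrite -mulr_sumr sqrtrM ?sqr_ge0 // sqrtr_sqr ger0_norm.
Qed.

(** The factor 2 is a convenient bound for the square root of 3. *)
Lemma enorm_le_coord x (c : R) :
  0 <= c -> (forall i, `|x ord0 i| <= c) -> enorm x <= 2 * c.
Proof.
move=> c0 xc; rewrite -[leRHS]ger0_norm ?mulr_ge0 // -sqrtr_sqr ler_wsqrtr //.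
apply: (@le_trans _ _ (\sum_(i < 3) c ^+ 2)).
  apply: ler_sum => i _.
  by rewrite -real_normK ?num_real // lerXn2r ?nnegrE.
rewrite sumr_const card_ord; have := sqr_ge0 c; nra.
Qed.

Definition side t : 'rV[R]_3 := t.2 - t.1.

Lemma sideE t i : side t ord0 i = t.2 ord0 i - t.1 ord0 i.
Proof. by rewrite !mxE. Qed.

Lemma midpointE t i : midpoint t ord0 i = (t.1 ord0 i + t.2 ord0 i) / 2.
Proof. by rewrite !mxE mulrC. Qed.

Lemma side_gt0 t i : proper_box t -> 0 < side t ord0 i.
Proof. by move=> /(_ i); rewrite sideE subr_gt0. Qed.

Lemma in_box_corner t : proper_box t -> in_box t t.2.
Proof. by move=> pt; apply/forallP => i; rewrite pt lexx. Qed.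

Lemma in_box_midpoint t : proper_box t -> in_box t (midpoint t).
Proof.
by move=> pt; apply/forallP => i; rewrite midpointE; have := pt i; lra.
Qed.

Lemma in_box_sub t x y i :
  in_box t x -> in_box t y -> `|x ord0 i - y ord0 i| < side t ord0 i.
Proof.
move=> /forallP/(_ i) + /forallP/(_ i); rewrite sideE => *.
rewrite ltr_norml; lra.
Qed.

Lemma enorm_sub_in_box t x y :
  in_box t x -> in_box t y -> enorm (x - y) <= enorm (side t).
Proof.
move=> tx ty; apply: enorm_le => i.
apply: le_trans (ler_norm _); rewrite mxE [(- y) _ _]mxE.
exact/ltW/in_box_sub.
Qed.

Lemma diam_le t : proper_box t -> diam t <= enorm (side t).
Proof.
move=> pt; apply: ge_sup.
  exists (enorm (t.2 - t.2)), t.2; first exact: in_box_corner.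
  by exists t.2 => //; exact: in_box_corner.
by move=> _ [x tx [y ty <-]]; exact: enorm_sub_in_box.
Qed.

(** The lower corner is not in the half-open box, so the full diagonal is not attained. The upper
    corner and the midpoint give half of it, which suffices up to constants. *)
Lemma diam_ge t : proper_box t -> enorm (side t) / 2 <= diam t.
Proof.
move=> pt; apply: ub_le_sup.
  exists (enorm (side t)) => _ [x tx [y ty <-]]; exact: enorm_sub_in_box.
exists t.2; first exact: in_box_corner.
exists (midpoint t); first exact: in_box_midpoint.
rewrite mulrC -enormZ ?invr_ge0 //; congr enorm.
by apply/rowP => i; rewrite !mxE; lra.
Qed.

(** In each coordinate a point of a box differs from the midpoint by at most half a side, and the
    Euclidean norm dominates every coordinate. *)
Lemma dist_ge t s i : proper_box t -> proper_box s ->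
  `|midpoint t ord0 i - midpoint s ord0 i|
    <= dist t s + (side t ord0 i + side s ord0 i) / 2.
Proof.
move=> pt ps; rewrite -lerBlDr; apply: lb_le_inf.
  exists (enorm (t.2 - s.2)), t.2; first exact: in_box_corner.
  by exists s.2 => //; exact: in_box_corner.
move=> _ [x tx [y sy <-]]; apply: le_trans (enorm_ge_coord _ i).
move: tx sy => /forallP/(_ i) tx /forallP/(_ i) sy.
rewrite !midpointE !sideE mxE [(- y) _ _]mxE lerBlDr ler_norml.
have := ler_norm (x ord0 i - y ord0 i).
have := ler_norm (- (x ord0 i - y ord0 i)); rewrite normrN; lra.
Qed.

Definition grid_box T l (k : 'I_3 -> nat) : box R :=
  (\row_i (T.1 ord0 i + (k i)%:R * (side T ord0 i / 2 ^+ l)),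
   \row_i (T.1 ord0 i + (k i).+1%:R * (side T ord0 i / 2 ^+ l))).

Lemma side_grid_box T l k : side (grid_box T l k) = (2 ^- l) *: side T.
Proof. by apply/rowP => i; rewrite sideE !mxE -natr1; ring. Qed.

Lemma midpoint_grid_box T l k i :
  midpoint (grid_box T l k) ord0 i
    = T.1 ord0 i + ((k i)%:R + 2^-1) * (side T ord0 i / 2 ^+ l).
Proof. by rewrite midpointE !mxE -natr1; field. Qed.

Lemma grid_box_proper T l k : proper_box T -> proper_box (grid_box T l k).
Proof.
move=> pT i; rewrite -subr_gt0 -sideE side_grid_box mxE.
by rewrite mulr_gt0 ?side_gt0 // invr_gt0 exprn_gt0.
Qed.

Lemma octant_grid_box T l k e :
  octant (grid_box T l k) e = grid_box T l.+1 (fun i => e i + (k i).*2)%N.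
Proof.
congr pair; apply/rowP => i; rewrite !mxE -!natr1 exprS.
all: rewrite -mul2n natrD natrM.
all: have l0 : 2 ^+ l != 0 :> R by rewrite expf_neq0 ?pnatr_eq0.
all: by case: (e i) => /=; field.
Qed.

Lemma midpoint_octant t e i : proper_box t ->
  `|midpoint (octant t e) ord0 i - midpoint t ord0 i| <= side t ord0 i / 4.
Proof.
move=> /(_ i) pt; rewrite !midpointE sideE /= !mxE ler_norml.
by case: (e i); lra.
Qed.

(** Halving the interval with index [k] gives the intervals with indices [2k] and [2k + 1] on the
    next level. *)
Lemma cluster_grid_box (P : {fset 'rV[R]_3}) n T l t :
  Defs.cluster P n T l t ->
  exists2 k : 'I_3 -> nat, (forall i, k i < 2 ^ l)%N & t = grid_box T l k.
Proof.
elim=> [|{}l {}t t' _ [k kl ->] [_ [e [-> _]]]].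
  exists (fun=> 0%N) => [i|]; first by [].
  rewrite [LHS]surjective_pairing; congr pair; apply/rowP => i.
    by rewrite !mxE; ring.
  by rewrite !mxE; field.
rewrite octant_grid_box; eexists; last by [].
move=> i; have := kl i; rewrite expnS; case: (e i) => /=; lia.
Qed.

End Geometry.

(** * Finite depth of the cluster trees *)

Lemma pow2_archi {R : realType} (x y : R) : 0 < y ->
  exists L : nat, forall l, (L <= l)%N -> x / 2 ^+ l <= y.
Proof.
move=> y0; exists (Num.bound `|x / y|) => l Ll.
rewrite ler_pdivrMr ?exprn_gt0 // mulrC -ler_pdivrMr //.
apply: le_trans (ler_norm _) _; apply/ltW.
apply: lt_le_trans (archi_boundP (normr_ge0 _)) _.
by rewrite -natrX ler_nat (leq_trans Ll) // ltnW // ltn_expl.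
Qed.

Section Depth.
Context {R : realType} (P : {fset 'rV[R]_3}) (n : nat) (T : box R).
Hypothesis (n_gt0 : (0 < n)%N).

(** Once the side in a coordinate where the points differ has shrunk to their difference there, no
    half-open grid box holds both. The condition [xy.1 != xy.2] stays inside the existential so that
    [choice] yields a level for every pair. *)
Lemma separating_level (xy : 'rV[R]_3 * 'rV[R]_3) :
  exists L : nat, xy.1 != xy.2 -> forall l k, (L <= l)%N ->
    in_box (grid_box T l k) xy.1 -> ~~ in_box (grid_box T l k) xy.2.
Proof.
case: xy => x y /=; have [->|xy] := eqVneq x y; first by exists 0%N.
have [i xyi] : exists i, x ord0 i != y ord0 i.
  apply/existsP; rewrite -negb_forall; apply: contra xy => /forallP xy.
  by apply/eqP/rowP => i; exact/eqP.
have [|L HL] := pow2_archi (side T ord0 i) `|x ord0 i - y ord0 i|.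
  by rewrite normr_gt0 subr_eq0.
exists L => _ l k /HL sl kx; apply/negP => /(in_box_sub _ _ _ i kx).
by rewrite side_grid_box mxE mulrC ltNge sl.
Qed.

(* A box that is subdivided contains two distinct points, hence is larger than
   the minimal distance of points of P. *)
Lemma cluster_level_bounded :
  exists L : nat, forall l t, Defs.cluster P n T l t -> (l <= L)%N.
Proof.
have [f Hf] := choice separating_level.
(* The separation argument applies to the subdivided parent, one level higher up; hence the
   successor. *)
exists (\max_(x <- P) \max_(y <- P) f (x, y)).+1 => _ _ [|l t t' tl [nt _]].
  by [].
rewrite ltnS leqNgt; apply/negP => ltl; apply: nt.
have [k _ tE] := cluster_grid_box _ _ _ _ _ tl.
rewrite /cluster_leaf (leq_trans _ n_gt0) // leqNgt; apply/negP.
rewrite /npoints cardfE => /card_gt1P[[x /[dup] + xA] [[y /[dup] + yA] [_ _ xy]]].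
rewrite !inE /= => /andP[xP xt] /andP[yP yt].
have {}xy : x != y by exact: xy.
have := Hf (x, y) xy l k _; rewrite /= -tE => /(_ _ xt)/negP; apply => //.
apply: leq_trans (ltnW ltl).
apply: leq_trans (leq_bigmax_seq (F := fun x => \max_(y <- P) f (x, y)) x xP _) => //.
exact: (leq_bigmax_seq (F := fun y => f (x, y))).
Qed.

(** [depth] is a maximum over an [fset_set], which is meaningful only once the set of levels is
    known to be finite. *)
Lemma cluster_le_depth l t : Defs.cluster P n T l t -> (l <= depth P n T)%N.
Proof.
move=> lt; apply: (leq_bigmax_seq (F := id)) => //.
have [L HL] := cluster_level_bounded.
rewrite in_fset_set ?inE; first by exists t.
apply: (sub_finite_set _ (finite_II L.+1)) => m [s /HL].
by rewrite /= ltnS.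
Qed.

End Depth.

(** * Counting by enumeration *)

Section Counting.

(** Repetitions in [s] are harmless, so the enumerations used later need not be injective. *)
Lemma card_fset_set_le (T : choiceType) (X : set T) (s : seq T) :
  X `<=` [set` s] -> (#|` fset_set X| <= size s)%N.
Proof.
move=> Xs.
have fX : finite_set X by apply: sub_finite_set Xs _; exact: finite_seq.
apply: leq_trans (size_undup s); rewrite -(size_seq_fset tt).
apply: fsubset_leq_card; apply/fsubsetP => x.
by rewrite in_fset_set // seq_fsetE inE; exact: Xs.
Qed.

(** Level 0 is kept apart: the root has no parent whose inadmissibility restricts it, and it
    contributes at most one element. *)
Lemma card_levels (K : choiceType) (X : set (nat * K)) (x0 : K) (p : nat)
    (s : nat -> seq K) :
  (forall l x, X (l, x) -> (l <= p)%N) ->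
  (forall x, X (0%N, x) -> x = x0) ->
  (forall l x, X (l.+1, x) -> x \in s l.+1) ->
  (#|` fset_set X| <= 1 + \sum_(1 <= l < p.+1) size (s l))%N.
Proof.
move=> Xp X0 Xs.
pose r := (0%N, x0) :: flatten [seq [seq (l, x) | x <- s l] | l <- index_iota 1 p.+1].
have -> : (1 + \sum_(1 <= l < p.+1) size (s l))%N = size r.
  rewrite /= size_flatten sumnE !big_map; congr _.+1.
  by apply: eq_bigr => l _; rewrite size_map.
apply: card_fset_set_le => -[[|l] x] Xlx; rewrite /= inE.
  by rewrite (X0 _ Xlx) eqxx.
apply/orP; right; apply/flatten_mapP; exists l.+1.
  by rewrite mem_index_iota; exact: Xp Xlx.
by apply/mapP; exists x => //; exact: Xs.
Qed.

Context {R : realType}.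

Lemma card_close n (c h B : R) : 0 < h -> 0 <= B ->
  #|[pred j : 'I_n | `|c + j%:R * h| <= B]|%:R <= 1 + 2 * B / h.
Proof.
move=> h0 B0; set A := [pred j | _].
have Bh0 : 0 <= 2 * B / h by rewrite divr_ge0 ?mulr_ge0 // ltW.
have [j0 Aj0|A0] := pickP A; last by rewrite eq_card0 // addr_ge0.
have [i Ai imin] := @arg_minnP _ j0 A (@nat_of_ord n) Aj0.
rewrite addrC (le_trans _ (_ : (Num.trunc (2 * B / h)).+1%:R <= _)) //; last first.
  by rewrite -natr1 lerD2r truncn_le.
rewrite ler_nat -[leqRHS]card_ord.
pose f (j : 'I_n) : 'I_(Num.trunc (2 * B / h)).+1 := inord (j - i).
have f_lt j : A j -> (j - i < (Num.trunc (2 * B / h)).+1)%N.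
  move=> Aj; rewrite ltnS truncn_ge_nat // natrB ?imin //.
  rewrite ler_pdivlMr //; move: Aj Ai; rewrite /A /= !ler_norml; lra.
rewrite -(card_in_image (f := f) (A := A)) ?max_card // => j k Aj Ak /(congr1 val).
rewrite /= !inordK ?f_lt //.
by move=> /eqP; rewrite eqn_sub2rE ?imin // => /eqP/val_inj.
Qed.

(** For each fixed second index, [card_close] bounds the number of first indices. *)
Lemma card_close_pair n (c : 'I_n -> R) (h B : R) : 0 < h -> 0 <= B ->
  #|[pred pq : 'I_n * 'I_n | `|c pq.2 + pq.1%:R * h| <= B]|%:R
    <= n%:R * (1 + 2 * B / h).
Proof.
move=> h0 B0; rewrite -sum1_card.
rewrite (eq_bigl (fun pq : 'I_n * 'I_n => true && (`|c pq.2 + pq.1%:R * h| <= B))) //.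
rewrite -(pair_big_dep predT (fun p q : 'I_n => `|c q + p%:R * h| <= B) (fun _ _ => 1%N)) /=.
rewrite (exchange_big_dep predT) //= natr_sum.
apply: le_trans (_ : \sum_(q < n) (1 + 2 * B / h) <= _); last first.
  by rewrite sumr_const card_ord -[leLHS]mulr_natl.
by apply: ler_sum => q _; rewrite sum1_card card_close.
Qed.

Lemma card_family3 (rT : finType) (F : 'I_3 -> pred rT) :
  #|[pred f : {ffun 'I_3 -> rT} | [forall i, F i (f i)]]|
    = (\prod_i #|F i|)%N.
Proof.
have := @card_family 'I_3 (fun=> rT) F.
rewrite foldrE big_image /= => <-.
by apply: eq_card => f.
Qed.

End Counting.

(** * Blocks: distance restriction and enumeration *)

Section Blocks.
Context {R : realType} (eta2 : R) (g : setting R).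
Hypothesis (eta2_gt0 : 0 < eta2).
Implicit Types (t s : box R) (i : 'I_3) (l : nat).

(** This diagonal replaces [q0] in the estimates because diagonals of clusters scale exactly with
    the level; the two agree up to a factor 2. *)
Definition root_side : R := Num.max (enorm (side (boxT g))) (enorm (side (boxS g))).
Definition gap_const : R := 3 + 4 / eta2.

(* Midpoints of the boxes of a block at level l + 1 differ by at most
   midpoint_gap (l + 1) in each coordinate, because the parent block is not
   admissible. *)
Definition midpoint_gap l : R :=
  gap_const * (root_side / 2 ^+ l) * (1 + kappa g * (root_side / 2 ^+ l)).

Lemma root_side_ge0 : 0 <= root_side. Proof. by rewrite /root_side le_max sqrtr_ge0. Qed.

Lemma gap_const_ge0 : 0 <= gap_const.
Proof. by rewrite /gap_const addr_ge0 // divr_ge0 // ltW. Qed.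

Lemma root_side_le : root_side <= 2 * q0 g.
Proof.
have := diam_ge _ (boxT_proper g); have := diam_ge _ (boxS_proper g).
rewrite /root_side /q0 ge_max !maxEle; case: ifP; lra.
Qed.

Lemma midpoint_gap_ge0 l : 0 <= midpoint_gap l.
Proof.
have d0 : 0 <= root_side / 2 ^+ l by rewrite divr_ge0 ?root_side_ge0 ?exprn_ge0.
have kd : 0 <= kappa g * (root_side / 2 ^+ l).
  by rewrite mulr_ge0 // ltW // kappa_gt0.
by rewrite /midpoint_gap mulr_ge0 ?addr_ge0 // mulr_ge0 // gap_const_ge0.
Qed.

Lemma block_cluster l t s : block eta2 g l t s ->
  Defs.cluster (PT g) (nmax g) (boxT g) l t /\
  Defs.cluster (PS g) (nmax g) (boxS g) l s.
Proof.
elim=> [|{}l {}t {}s t' s' _ [ct cs] _ tt' ss']; first by split; constructor.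
by split; [apply: cluster_child ct tt'|apply: cluster_child cs ss'].
Qed.

Lemma block_level l t s : block eta2 g l t s -> (l <= pmin g)%N.
Proof.
move=> /block_cluster[ct cs]; rewrite leq_min.
have n0 := nmax_gt0 g.
by rewrite (cluster_le_depth _ _ _ n0 _ _ ct) (cluster_le_depth _ _ _ n0 _ _ cs).
Qed.

(** Whichever of the two criteria fails, one summand on the right bounds the left side; the sum
    covers both cases. *)
Lemma dist_le_of_nonadmissible t s (d : R) :
  0 <= diam t -> diam t <= d -> diam s <= d -> ~ admissible eta2 g t s ->
  eta2 * dist t s <= d + kappa g * d ^+ 2.
Proof.
move=> t0 td sd; set m := Num.max (diam t) (diam s).
have md : m <= d by rewrite ge_max td sd.
have m0 : 0 <= m by rewrite le_max t0.
have k0 := kappa_gt0 g.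
have kd : 0 <= kappa g * d ^+ 2.
  by rewrite mulr_ge0 ?sqr_ge0 // ltW.
rewrite not_andP /critA1 /critA3 -/m => -[/negP|/negP]; rewrite -ltNge => h.
  lra.
have : kappa g * m ^+ 2 <= kappa g * d ^+ 2.
  by rewrite ler_pM2l // lerXn2r // nnegrE (le_trans m0).
lra.
Qed.

Lemma side_cluster_le P n T l t i : proper_box T ->
  Defs.cluster P n T l t ->
  [/\ proper_box t, enorm (side t) = enorm (side T) / 2 ^+ l &
      0 <= side t ord0 i <= enorm (side T) / 2 ^+ l].
Proof.
move=> pT /cluster_grid_box[k _ ->].
have pk : proper_box (grid_box T l k) by exact: grid_box_proper.
have sE : enorm (side (grid_box T l k)) = enorm (side T) / 2 ^+ l.
  by rewrite side_grid_box enormZ ?invr_ge0 ?exprn_ge0 // mulrC.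
split=> //; rewrite -sE ltW ?side_gt0 //=.
by apply: le_trans (enorm_ge_coord _ i); exact: ler_norm.
Qed.

(** With [d] the root diagonal scaled to level [l + 1], the parents have diagonals at most [2 * d].
    Their half sides contribute [2 * d], the two passages to an octant [d / 2] each, and the
    distance at most [(2 * d + kappa g * (2 * d) ^+ 2) / eta2]. *)
Lemma block_midpoint_le l t s i : block eta2 g l.+1 t s ->
  `|midpoint t ord0 i - midpoint s ord0 i| <= midpoint_gap l.+1.
Proof.
move=> b; inversion b as [|? t0 s0 ? ? b0 nleaf [_ [e [tE _]]] [_ [e' [sE _]]]].
subst; have [ct cs] := block_cluster _ _ _ b0.
have [pt et /andP[st0 st]] := side_cluster_le _ _ _ _ _ i (boxT_proper g) ct.
have [ps es /andP[ss0 ss]] := side_cluster_le _ _ _ _ _ i (boxS_proper g) cs.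
rewrite /midpoint_gap; set d := root_side / 2 ^+ l.+1.
have dE : 2 * d = root_side / 2 ^+ l by rewrite /d exprS; field; rewrite expf_neq0 ?pnatr_eq0.
have d0 : 0 <= d by rewrite divr_ge0 ?root_side_ge0 ?exprn_ge0.
have DT : enorm (side (boxT g)) / 2 ^+ l <= 2 * d.
  by rewrite dE ler_pM2r ?invr_gt0 ?exprn_gt0 // le_max lexx.
have DS : enorm (side (boxS g)) / 2 ^+ l <= 2 * d.
  by rewrite dE ler_pM2r ?invr_gt0 ?exprn_gt0 // le_max lexx orbT.
have := dist_le_of_nonadmissible t0 s0 (2 * d).
have dt := diam_le _ pt; have ds := diam_le _ ps; have dt' := diam_ge _ pt.
have et0 : 0 <= enorm (side t0) by exact: sqrtr_ge0.
move=> /(_ ltac:(lra) ltac:(lra) ltac:(lra)) Hd.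
have {Hd} : eta2 * dist t0 s0 <= 2 * d + kappa g * (2 * d) ^+ 2.
  by apply: Hd => adm; apply: nleaf; apply: Or33.
rewrite mulrC -ler_pdivlMr // => Hd.
have := dist_ge _ _ i pt ps.
have := midpoint_octant _ e i pt; have := midpoint_octant _ e' i ps.
rewrite !ler_norml => /andP[h1 h2] /andP[h3 h4] /andP[h5 h6].
have k0 := kappa_gt0 g.
have kd : 0 <= kappa g * d by rewrite mulr_ge0 // ltW.
have kdd : 0 <= kappa g * d * d by rewrite mulr_ge0.
have i0 : 0 < eta2^-1 by rewrite invr_gt0.
have di : 0 <= d * eta2^-1 by rewrite mulr_ge0 // ltW.
(* The first two terms are the contributions estimated above; the last two are nonnegative slack. *)
have E : gap_const * d * (1 + kappa g * d) = 3 * d + (2 * d + kappa g * (2 * d) ^+ 2) / eta2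
  + 3 * (kappa g * d * d) + 2 * (d * eta2^-1) by rewrite /gap_const; ring.
by rewrite E; apply/andP; split; lra.
Qed.

Lemma Lplus_level l t s : Lplus eta2 g (l, (t, s)) -> (l <= pmin g)%N.
Proof. by case=> /block_level. Qed.

Lemma block0 t s : block eta2 g 0 t s -> t = boxT g /\ s = boxS g.
Proof. by move=> b; inversion b. Qed.

(** The midpoint difference is arranged as an offset depending on [pq.2] plus [pq.1] grid widths, as
    [card_close_pair] requires. Only coordinate [i] of the grid box is read, so a constant index
    function suffices. *)
Definition block_count l i : nat :=
  #|[pred pq : 'I_(2 ^ l) * 'I_(2 ^ l) |
     `|(boxT g).1 ord0 i + 2^-1 * (side (boxT g) ord0 i / 2 ^+ l)
       - midpoint (grid_box (boxS g) l (fun=> pq.2)) ord0 i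
       + pq.1%:R * (side (boxT g) ord0 i / 2 ^+ l)| <= midpoint_gap l]|.

(** A block is encoded by one pair of grid indices per direction, and the distance conditions in the
    three directions are independent; hence the product. *)
Lemma N_C_le :
  (N_C eta2 g <= 1 + \sum_(1 <= l < (pmin g).+1) \prod_i block_count l i)%N.
Proof.
pose A l i (pq : 'I_(2 ^ l) * 'I_(2 ^ l)) :=
  `|(boxT g).1 ord0 i + 2^-1 * (side (boxT g) ord0 i / 2 ^+ l)
          - midpoint (grid_box (boxS g) l (fun=> pq.2)) ord0 i
          + pq.1%:R * (side (boxT g) ord0 i / 2 ^+ l)| <= midpoint_gap l.
pose F l (f : {ffun 'I_3 -> 'I_(2 ^ l) * 'I_(2 ^ l)}) : box R * box R :=
  (grid_box (boxT g) l (fun i => (f i).1), grid_box (boxS g) l (fun i => (f i).2)).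
pose s l := [seq F l f | f in [pred f : {ffun _} | [forall i, A l i (f i)]]].
apply: leq_trans (card_levels _ (Lplus eta2 g) (boxT g, boxS g) (pmin g) s _ _ _) _.
- by move=> l [t r]; exact: Lplus_level.
- by move=> [t r] [/block0/= [-> ->]].
- move=> l [t r] [/= b _ _]; have [ct cs] := block_cluster _ _ _ b.
  have [k kl tE] := cluster_grid_box _ _ _ _ _ ct.
  have [k' kl' rE] := cluster_grid_box _ _ _ _ _ cs.
  apply/fintype.imageP; exists [ffun i => (Ordinal (kl i), Ordinal (kl' i))].
    apply/forallP => i; rewrite /A ffunE /=.
    have := block_midpoint_le _ _ _ i b; rewrite tE rE !midpoint_grid_box.
    by apply: le_trans; rewrite le_eqVlt; apply/orP; left; apply/eqP; congr `|_|; ring.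
  rewrite /F tE rE; congr pair; congr pair; apply/rowP => i; rewrite !mxE !ffunE //.
- by rewrite leq_add2l leq_sum // => l _; rewrite size_image card_family3.
Qed.

(** * Keys for root boxes identical up to translation *)

Section Translates.
Hypothesis (TS : translates (boxT g) (boxS g)).

Lemma side_translates : side (boxS g) = side (boxT g).
Proof.
by case: TS => v ->; apply/rowP => i; rewrite !mxE; ring.
Qed.

(** The value of the midpoint difference for grid index difference [- 2 ^ l]. It is the same on all
    levels, since [2 ^ l] grid widths make up one root side. *)
Definition key_shift i : R :=
  (boxT g).1 ord0 i - (boxS g).1 ord0 i - side (boxT g) ord0 i.

Definition key_count l i : nat :=
  #|[pred j : 'I_(2 ^ l.+1) |
     `|key_shift i + j%:R * (side (boxT g) ord0 i / 2 ^+ l)| <= midpoint_gap l]|.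

(* The integer coordinates of m_t - m_s are shifted by 2 ^ l to make them
   natural numbers below 2 ^ (l + 1). *)
Lemma N_SC_le :
  (N_SC eta2 g <= 1 + \sum_(1 <= l < (pmin g).+1) \prod_i key_count l i)%N.
Proof.
pose A l i (j : 'I_(2 ^ l.+1)) :=
  `|key_shift i + j%:R * (side (boxT g) ord0 i / 2 ^+ l)| <= midpoint_gap l.
pose F l (f : {ffun 'I_3 -> 'I_(2 ^ l.+1)}) : 'rV[R]_3 :=
  \row_i (key_shift i + (f i)%:R * (side (boxT g) ord0 i / 2 ^+ l)).
pose s l := [seq F l f | f in [pred f : {ffun _} | [forall i, A l i (f i)]]].
apply: leq_trans (card_levels _ _ (midpoint (boxT g) - midpoint (boxS g)) (pmin g) s _ _ _) _.
- by move=> l x [[l' [t r]] L [<- _]]; exact: Lplus_level L.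
- by move=> x [[l' [t r]] /[swap] -[/= -> <-] [/block0/= [-> ->]]].
- move=> l x [[l' [t r]] /[swap] -[/= -> <-] [/= b _ _]].
  have [ct cs] := block_cluster _ _ _ b.
  have [k kl tE] := cluster_grid_box _ _ _ _ _ ct.
  have [k' kl' rE] := cluster_grid_box _ _ _ _ _ cs.
  (* The natural subtraction does not truncate, because [k' i < 2 ^ l.+1]. *)
  have jl i : (k i + (2 ^ l.+1 - k' i) < 2 ^ l.+2)%N.
    by have := kl i; have := kl' i; rewrite !expnS; lia.
  have jE i : key_shift i + (k i + (2 ^ l.+1 - k' i))%:R * (side (boxT g) ord0 i / 2 ^+ l.+1)
     = midpoint t ord0 i - midpoint r ord0 i.
    have p0 : 2 ^+ l.+1 != 0 :> R by rewrite expf_neq0 ?pnatr_eq0.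
    rewrite tE rE !midpoint_grid_box side_translates natrD natrB; last exact/ltnW/kl'.
    rewrite natrX /key_shift; move: (2 ^+ l.+1) p0 => p p0.
    by field.
  apply/fintype.imageP; exists [ffun i => Ordinal (jl i)].
    apply/forallP => i; rewrite /A ffunE /= jE; exact: block_midpoint_le b.
  by apply/rowP => i; rewrite [RHS]mxE ffunE /= jE !mxE.
- by rewrite leq_add2l leq_sum // => l _; rewrite size_image card_family3.
Qed.

(** At depth 0 only the root pair can be a block. *)
Lemma N_SC_eq0 : pmin g = 0%N -> ~ admissible eta2 g (boxT g) (boxS g) ->
  N_SC eta2 g = 0%N.
Proof.
move=> p0 nadm; apply/eqP; rewrite -leqn0.
apply: (card_fset_set_le _ _ [::]) => x [[l [t r]] L _].
have := Lplus_level _ _ _ L; rewrite p0 leqn0 => /eqP l0.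
by case: L => /=; rewrite l0 => /block0[-> ->].
Qed.

End Translates.

Section CountBound.
Variables (M : R) (i : 'I_3).
Hypothesis (DM : root_side <= M * side (boxT g) ord0 i).

(** The powers of 2 in front cancel between gap and grid width, leaving the ratio of root diagonal
    to side, at most [M]. The 4 combines the interval length [2 * midpoint_gap] with
    [root_side_le]. *)
Lemma count_bound l :
  1 + 2 * midpoint_gap l / (side (boxT g) ord0 i / 2 ^+ l)
    <= (1 + 4 * M * gap_const) * (1 + kappa g * q0 g / 2 ^+ l).
Proof.
have w0 := side_gt0 _ i (boxT_proper g); have DMw := DM.
set w := side _ _ _ in w0 DMw *; set p := 2 ^+ l.
have p0 : 0 < p :> R by rewrite exprn_gt0.
have k0 := kappa_gt0 g.
have D0 := root_side_ge0; have Dq := root_side_le; have K00 := gap_const_ge0.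
have M0 : 0 <= M by rewrite -(pmulr_lge0 _ w0) (le_trans D0).
have q00 : 0 <= q0 g by lra.
have x0 : 0 <= kappa g * q0 g / p by rewrite divr_ge0 ?mulr_ge0 // ltW.
have -> : 2 * midpoint_gap l / (w / p) = 2 * gap_const * (1 + kappa g * root_side / p) * (root_side / w).
  by rewrite /midpoint_gap -/p; field; rewrite ?gt_eqF.
have DwM : root_side / w <= M by rewrite ler_pdivrMr.
have Dw0 : 0 <= root_side / w by rewrite divr_ge0 // ltW.
have h1 : 1 + kappa g * root_side / p <= 2 * (1 + kappa g * q0 g / p).
  have : kappa g * root_side / p <= 2 * (kappa g * q0 g / p).
    rewrite mulrA ler_pM2r ?invr_gt0 // mulrCA ler_pM2l //.
  lra.
have h0 : 0 <= 1 + kappa g * root_side / p.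
  by rewrite addr_ge0 // divr_ge0 ?mulr_ge0 // ltW.
have h2 : 2 * gap_const * (1 + kappa g * root_side / p) * (root_side / w)
    <= 2 * gap_const * (2 * (1 + kappa g * q0 g / p)) * M.
  apply: ler_pM => //; first by rewrite !mulr_ge0.
  by apply: ler_wpM2l => //; rewrite mulr_ge0.
apply: le_trans (_ : 1 + 2 * gap_const * (2 * (1 + kappa g * q0 g / p)) * M <= _).
  by rewrite lerD2l.
have -> : (1 + 4 * M * gap_const) * (1 + kappa g * q0 g / p) =
  1 + 2 * gap_const * (2 * (1 + kappa g * q0 g / p)) * M + kappa g * q0 g / p by ring.
by rewrite lerDl.
Qed.

End CountBound.

End Blocks.

(** * Bounds per level and their sums *)

Section LevelBounds.
Context {R : realType}.
Implicit Types (x K P : R).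

Lemma prod3_le (n : 'I_3 -> nat) (a : R) :
  (forall i, (n i)%:R <= a) -> (\prod_i n i)%:R <= a ^+ 3.
Proof.
move=> na; rewrite natr_prod -[3%N in leRHS]card_ord -prodr_const.
by apply: ler_prod => i _; rewrite na ler0n.
Qed.

(** For [x <= P] the second bound is at most [(2 * K) ^+ 3]. For [x > P] and [P ^+ 3 <= x ^+ 2] the
    first is at most [8 * x ^+ 2]. In the remaining range [x <= x ^+ 2 < P ^+ 3], so
    [(x / P) ^+ 3 <= x ^+ 2] and the second bound works again. *)
Lemma key_level_le (n x K P : R) : 0 <= x -> 1 <= K -> 1 <= P ->
  n <= (2 * P) ^+ 3 -> n <= (K * (1 + x / P)) ^+ 3 ->
  n <= 8 * K ^+ 3 * Num.max 1 (x ^+ 2).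
Proof.
move=> x0 K1 P1 nP nK; set m := Num.max _ _.
have P0 : 0 < P by lra.
have m1 : 1 <= m by rewrite le_max lexx.
have mx : x ^+ 2 <= m by rewrite le_max lexx orbT.
have K31 : 1 <= K ^+ 3 by rewrite exprn_ege1.
have u0 : 0 <= x / P by rewrite divr_ge0 // ltW.
have [xP|Px] := leP x P.
  apply: le_trans nK _; apply: (@le_trans _ _ ((K * 2) ^+ 3)).
    have : x / P <= 1 by rewrite ler_pdivrMr // mul1r.
    by move=> u1; apply: lerXn2r; rewrite ?nnegrE; [nra|nra|nra].
  by rewrite exprMn; nra.
have [Px2|xP2] := leP (P ^+ 3) (x ^+ 2).
  apply: le_trans nP _; rewrite exprMn; nra.
apply: le_trans nK _; apply: (@le_trans _ _ ((K * (2 * (x / P))) ^+ 3)).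
  have : 1 <= x / P by rewrite ler_pdivlMr // mul1r ltW.
  by move=> u1; apply: lerXn2r; rewrite ?nnegrE; [nra|nra|nra].
have x3 : (x / P) ^+ 3 <= x ^+ 2.
  by rewrite expr_div_n ler_pdivrMr ?exprn_gt0 // exprSr ler_wpM2l ?sqr_ge0 //; nra.
have -> : (K * (2 * (x / P))) ^+ 3 = 8 * K ^+ 3 * (x / P) ^+ 3 by ring.
by apply: ler_wpM2l; [lra|exact: le_trans x3 _].
Qed.

(** The cube is that of [K * (P + x)]; the rest is convexity of the cube, made explicit by an
    identity with a nonnegative remainder. *)
Lemma block_level_le (n x K P : R) : 0 <= x -> 1 <= K -> 1 <= P ->
  n <= (P * (K * (1 + x / P))) ^+ 3 ->
  n <= 4 * K ^+ 3 * (P ^+ 3 + x ^+ 3).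
Proof.
move=> x0 K1 P1 nK; apply: le_trans nK _.
have -> : P * (K * (1 + x / P)) = K * (P + x) by field; lra.
rewrite exprMn [leRHS](_ : _ = K ^+ 3 * (4 * (P ^+ 3 + x ^+ 3))); last by ring.
apply: ler_wpM2l; first by rewrite exprn_ge0 //; lra.
have -> : 4 * (P ^+ 3 + x ^+ 3) = (P + x) ^+ 3 + 3 * (P - x) ^+ 2 * (P + x) by ring.
by have := sqr_ge0 (P - x); rewrite lerDl => ?; apply: mulr_ge0; lra.
Qed.

Lemma sum_pow8_le p : \sum_(1 <= l < p.+1) (8 : R) ^+ l <= 2 * 8 ^+ p.
Proof.
elim: p => [|p IHp]; first by rewrite big_geq // mulr_ge0.
rewrite big_nat_recr //= exprS.
have : 0 <= 8 ^+ p :> R by rewrite exprn_ge0.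
lra.
Qed.

Lemma sum_nat_le p (n : nat -> nat) (a : R) :
  (forall l, (0 < l <= p)%N -> (n l)%:R <= a) ->
  (1 + \sum_(1 <= l < p.+1) n l)%:R <= 1 + p%:R * a.
Proof.
move=> na; rewrite natrD natr_sum lerD2l.
apply: le_trans (_ : \sum_(1 <= l < p.+1) a <= _).
  by rewrite big_nat [leRHS]big_nat ler_sum // => l; exact: na.
by rewrite sumr_const_nat subn1 -[leLHS]mulr_natl.
Qed.

Variables (eta2 : R) (g : setting R).
Hypothesis (eta2_gt0 : 0 < eta2).

Definition level_const (M : R) : R := 1 + 4 * M * gap_const eta2.

Lemma level_const_ge1 M : 0 <= M -> 1 <= level_const M.
Proof. by move=> M0; rewrite lerDl !mulr_ge0 // gap_const_ge0. Qed.

Lemma kappa_q0_ge0 : 0 <= kappa g * q0 g.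
Proof.
have := root_side_ge0 g; have := root_side_le g; have := kappa_gt0 g.
by move=> *; rewrite mulr_ge0 //; lra.
Qed.

Lemma key_count_le_pow l i : (key_count eta2 g l i)%:R <= 2 * 2 ^+ l :> R.
Proof.
rewrite -exprS -natrX ler_nat -[leqRHS]card_ord; exact: max_card.
Qed.

Lemma key_count_le l i (M : R) : root_side g <= M * side (boxT g) ord0 i ->
  (key_count eta2 g l i)%:R <= level_const M * (1 + kappa g * q0 g / 2 ^+ l).
Proof.
move=> DM; apply: le_trans (count_bound _ _ eta2_gt0 _ _ DM l).
apply: card_close; last exact: midpoint_gap_ge0.
by rewrite divr_gt0 ?exprn_gt0 // side_gt0 //; exact: boxT_proper.
Qed.

Lemma block_count_le l i (M : R) : root_side g <= M * side (boxT g) ord0 i ->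
  (block_count eta2 g l i)%:R
    <= 2 ^+ l * (level_const M * (1 + kappa g * q0 g / 2 ^+ l)).
Proof.
move=> DM; pose h := side (boxT g) ord0 i / 2 ^+ l.
apply: (@le_trans _ _ (2 ^+ l * (1 + 2 * midpoint_gap eta2 g l / h))).
  rewrite -natrX; pose c (q : 'I_(2 ^ l)) := (boxT g).1 ord0 i + 2^-1 * h
    - midpoint (grid_box (boxS g) l (fun=> q)) ord0 i.
  apply: (@card_close_pair _ _ c h); last exact: midpoint_gap_ge0.
  by rewrite divr_gt0 ?exprn_gt0 // side_gt0 //; exact: boxT_proper.
by rewrite ler_pM2l ?exprn_gt0 // count_bound.
Qed.

Lemma aspect_ratio_side (rho : R) i : aspect_ratio_le rho (boxT g) -> 1 <= rho ->
  enorm (side (boxT g)) <= 2 * (rho * side (boxT g) ord0 i).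
Proof.
move=> ar rho1; have w0 j := side_gt0 _ j (boxT_proper g).
apply: enorm_le_coord => [|j]; first by rewrite mulr_ge0 ?ltW //; lra.
by rewrite gtr0_norm // !sideE; exact: ar.
Qed.

Lemma root_side_translates : translates (boxT g) (boxS g) ->
  root_side g = enorm (side (boxT g)).
Proof. by move=> TS; rewrite /root_side side_translates // maxxx. Qed.

(** The geometric series costs a factor 2, which turns 4 into 8; the summand 1 for the root is
    absorbed by [8 ^+ pmin g]. *)
Lemma N_C_bound (M : R) : 0 <= M ->
  (forall i, root_side g <= M * side (boxT g) ord0 i) ->
  (N_C eta2 g)%:R <= (8 * level_const M ^+ 3 + 1)
     * ((pmin g)%:R * (kappa g * q0 g) ^+ 3 + 8 ^+ pmin g).
Proof.
move=> M0 DM; have K1 := level_const_ge1 _ M0; have x0 := kappa_q0_ge0.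
set K := level_const M in K1 *; set x := kappa g * q0 g in x0 *.
set p := pmin g.
apply: (@le_trans _ _ (1 + \sum_(1 <= l < p.+1) 4 * K ^+ 3 * (8 ^+ l + x ^+ 3))).
  apply: le_trans (_ : (1 + \sum_(1 <= l < p.+1) \prod_i block_count eta2 g l i)%:R <= _).
    by rewrite ler_nat; exact: N_C_le.
  rewrite natrD natr_sum lerD2l ler_sum // => l _.
  have -> : 8 ^+ l = (2 ^+ l) ^+ 3 :> R.
    by rewrite -exprM mulnC exprM; congr (_ ^+ _); ring.
  apply: block_level_le => //; first by rewrite exprn_ege1 // ler1n.
  by apply: prod3_le => i; exact: block_count_le.
rewrite -mulr_sumr big_split /= sumr_const_nat subn1 -[x ^+ 3 *+ _]mulr_natl.
have := sum_pow8_le p; set s := \sum_(_ <= _ < _) _ => sp.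
have K3 : 1 <= K ^+ 3 by rewrite exprn_ege1.
have p8 : 1 <= 8 ^+ p :> R by rewrite exprn_ege1 // ler1n.
have px : 0 <= p%:R * x ^+ 3 by rewrite mulr_ge0 // exprn_ge0.
move: s (8 ^+ p) (p%:R * x ^+ 3) (K ^+ 3) sp K3 p8 px => s e z k sp K3 p8 px.
have : 4 * k * (s + z) <= 4 * k * (2 * e + z) by apply: ler_wpM2l; lra.
have : 0 <= k * z by rewrite mulr_ge0 //; lra.
lra.
Qed.

(** For [pmin g >= 1] the summand 1 for the root is absorbed by the added 1 in the constant. For
    [pmin g = 0] the right side vanishes, whereas an admissible root pair would give one key; hence
    the exclusion. *)
Lemma N_SC_bound (M : R) : 0 <= M -> translates (boxT g) (boxS g) ->
  (forall i, root_side g <= M * side (boxT g) ord0 i) ->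
  ~ (pmin g = 0%N /\ admissible eta2 g (boxT g) (boxS g)) ->
  (N_SC eta2 g)%:R <= (pmin g)%:R
     * ((8 * level_const M ^+ 3 + 1) * Num.max 1 ((kappa g * q0 g) ^+ 2)).
Proof.
move=> M0 TS DM npa; have K1 := level_const_ge1 _ M0; have x0 := kappa_q0_ge0.
have [p0|p0] := posnP (pmin g).
  by rewrite N_SC_eq0 // ?p0 ?mul0r // => adm; apply: npa.
set K := level_const M in K1 *; set x := kappa g * q0 g in x0 *.
set m := Num.max _ _; have m1 : 1 <= m by rewrite le_max lexx.
apply: (@le_trans _ _ (1 + (pmin g)%:R * (8 * K ^+ 3 * m))).
  apply: le_trans (_ : (1 + \sum_(1 <= l < (pmin g).+1) \prod_i key_count eta2 g l i)%:R <= _).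
    by rewrite ler_nat; exact: N_SC_le.
  apply: sum_nat_le => l _; apply: (key_level_le _ _ _ (2 ^+ l)) => //.
  - by rewrite exprn_ege1 // ler1n.
  - by apply: prod3_le => i; exact: key_count_le_pow.
  - by apply: prod3_le => i; exact: key_count_le.
have p1 : 1 <= (pmin g)%:R :> R by rewrite ler1n.
have : 1 <= (pmin g)%:R * m by rewrite mulr_ege1.
lra.
Qed.

(* Without control of the aspect ratio only the longest direction is used, the
   other two contribute at most 2 ^ (l + 1) values each. *)
Lemma N_SC_bound_longest (a x : R) : translates (boxT g) (boxS g) ->
  kappa g * q0 g <= x ->
  (forall l, (l <= pmin g)%N -> 2 ^+ l <= a) ->
  (N_SC eta2 g)%:R <= 1 + (pmin g)%:R * (4 * level_const 2 * (a ^+ 2 + x * a)).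
Proof.
move=> TS qx la; have K1 := level_const_ge1 2 ltac:(by []); have x0 := kappa_q0_ge0.
have w0 j := side_gt0 _ j (boxT_proper g).
have [i _ imax] := arg_maxP (side (boxT g) ord0) (erefl : xpredT (ord0 : 'I_3)).
have DM : root_side g <= 2 * side (boxT g) ord0 i.
  rewrite root_side_translates //; apply: enorm_le_coord => [|j]; first exact: ltW.
  by rewrite gtr0_norm //; exact: imax.
apply: le_trans (_ : (1 + \sum_(1 <= l < (pmin g).+1) \prod_i key_count eta2 g l i)%:R <= _).
  by rewrite ler_nat; exact: N_SC_le.
apply: sum_nat_le => l /andP[_ /la {}la].
rewrite (bigD1 i) //= natrM natr_prod.
have P0 : 0 < 2 ^+ l :> R by rewrite exprn_gt0.
have -> : 4 * level_const 2 * (a ^+ 2 + x * a) = level_const 2 * (a + x) * (4 * a) by ring.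
apply: (@le_trans _ _ ((level_const 2 * (1 + kappa g * q0 g / 2 ^+ l)) * (2 * 2 ^+ l) ^+ 2)).
  apply: ler_pM => //; [exact: prodr_ge0|exact: key_count_le|].
  have <- : \prod_(j < 3 | j != i) (2 * 2 ^+ l) = (2 * 2 ^+ l) ^+ 2 :> R.
    by rewrite prodr_const; congr (_ ^+ _); rewrite (cardC1 i) card_ord.
  apply: ler_prod => j _.
  by rewrite key_count_le_pow ler0n.
(* In this form both factors increase with [2 ^+ l], so [a] can replace it. *)
have -> : level_const 2 * (1 + kappa g * q0 g / 2 ^+ l) * (2 * 2 ^+ l) ^+ 2
   = level_const 2 * (2 ^+ l + kappa g * q0 g) * (4 * 2 ^+ l).
  by field; rewrite gt_eqF.
apply: ler_pM; [|lra| |lra]; first by apply: mulr_ge0; lra.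
by apply: ler_wpM2l; lra.
Qed.

(** Since [8 = 2 ^+ 3], raising 2 to the base-8 logarithm of [N] gives the cube root of [N]. *)
Lemma pow2_le_root3 (N l : nat) (c : R) : (0 < N)%N ->
  l%:R <= ln N%:R / ln 8 + c -> 2 ^+ l <= 2 `^ c * N%:R `^ (3^-1).
Proof.
move=> N0 lN; rewrite -powR_mulrn //.
apply: (@le_trans _ _ (2 `^ (ln N%:R / ln 8 + c))).
  by apply: ler_powR => //; rewrite ler1n.
rewrite powRD; last by rewrite pnatr_eq0 implybT.
rewrite mulrC ler_pM2l ?powR_gt0 // /powR !pnatr_eq0 (gtn_eqF N0) /=.
have -> : 8 = 2 ^+ 3 :> R by ring.
have l2 : 0 < ln 2 :> R by rewrite ln_gt0 // ltr1n.
rewrite lnXn // ler_expR le_eqVlt; apply/orP; left; apply/eqP.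
by field; rewrite gt_eqF.
Qed.

End LevelBounds.

Theorem theorem3 (R : realType) (eta2 : R) (eta2_gt0 : 0 < eta2) :
  (forall c_un rho : R, 1 <= c_un -> 1 <= rho ->
   exists2 c_C : R, 0 < c_C &
     (forall g : setting R,
        aspect_ratio_le rho (boxT g) -> aspect_ratio_le rho (boxS g) ->
        q0 g <= c_un * Num.min (diam (boxT g)) (diam (boxS g)) ->
        (N_C eta2 g)%:R
          <= c_C * ((pmin g)%:R * (kappa g * q0 g) ^+ 3 + 8 ^+ pmin g)) /\
     (forall g : setting R,
        aspect_ratio_le rho (boxT g) ->
        translates (boxT g) (boxS g) ->
        ~ (pmin g = 0%N /\ admissible eta2 g (boxT g) (boxS g)) ->
        (N_SC eta2 g)%:R
          <= (pmin g)%:R * Num.max c_C (c_C `^ (2 / 3) * (kappa g * q0 g) ^+ 2)))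
  /\
  (forall (m : nat) (c_ad c_geo : R), 0 <= c_ad -> 0 <= c_geo ->
   exists C : R, \forall N \near \oo, forall g : setting R,
     npts g = N ->
     translates (boxT g) (boxS g) ->
     (pmax g)%:R <= ln N%:R / ln 8 + c_ad ->
     kappa g * q0 g <= c_geo * N%:R `^ (3^-1) ->
     (storage eta2 g m)%:R <= C * (N%:R `^ (2 / 3) * ln N%:R)).
Proof.
split=> [c_un rho c1 rho1 | m c_ad c_geo cad0 cgeo0].
  (* From [root_side <= 2 * q0], [q0 <= c_un * diam] and diagonal at most [2 * rho] times any side.
     For translates [2 * rho] would do, and it is at most [M]. *)
  pose M : R := 4 * c_un * rho.
  have M0 : 0 <= M by rewrite !mulr_ge0 //; lra.
  have K1 := level_const_ge1 _ eta2_gt0 _ M0.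
  pose C : R := 8 * level_const eta2 M ^+ 3 + 1.
  have C1 : 1 <= C by rewrite lerDr mulr_ge0 // exprn_ge0 //; lra.
  have C3 : C <= C ^+ 3 by rewrite ler_eXnr.
  (* The cube makes the power with exponent [2 / 3] equal to [C ^+ 2], so both terms of the maximum
     dominate those obtained with [C]. *)
  exists (C ^+ 3); first by lra.
  split=> g arT.
    move=> _ q0le.
    have DM i : root_side g <= M * side (boxT g) ord0 i.
      have sT := aspect_ratio_side _ _ i arT rho1.
      have dT := diam_le _ (boxT_proper g).
      have Dq := root_side_le g.
      set m := Num.min _ _ in q0le.
      have mT : m <= diam (boxT g) by rewrite ge_min lexx.
      have : c_un * m <= c_un * (2 * (rho * side (boxT g) ord0 i)).
        by rewrite ler_wpM2l //; lra.
      have -> : M * side (boxT g) ord0 i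
        = 2 * (c_un * (2 * (rho * side (boxT g) ord0 i))) by rewrite /M; ring.
      lra.
    apply: le_trans (N_C_bound _ _ eta2_gt0 _ M0 DM) _.
    rewrite ler_wpM2r // addr_ge0 ?exprn_ge0 // mulr_ge0 // exprn_ge0 //.
    exact: kappa_q0_ge0.
  move=> TS npa.
  have DM i : root_side g <= M * side (boxT g) ord0 i.
    rewrite root_side_translates //.
    apply: le_trans (aspect_ratio_side _ _ i arT rho1) _.
    have w0 := side_gt0 _ i (boxT_proper g).
    have : 0 <= rho * side (boxT g) ord0 i by rewrite mulr_ge0 ?ltW //; lra.
    rewrite /M -[_ * rho * _]mulrA; move: (rho * _) => z z0.
    by nra.
  apply: le_trans (N_SC_bound _ _ eta2_gt0 _ M0 TS DM npa) _.
  apply: ler_wpM2l => //; rewrite -/C.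
  have -> : (C ^+ 3) `^ (2 / 3) = C ^+ 2.
    rewrite -powR_mulrn; last by lra.
    rewrite -powRrM (_ : _ * _ = 2%:R); last by field.
    by rewrite powR_mulrn //; lra.
  rewrite maxr_pMr; last by lra.
  rewrite mulr1 ge_max !le_max C3 /=.
  apply/orP; right; rewrite ler_wpM2r ?sqr_ge0 // expr2; nra.
(* With [y] the cube root of [N], [a * y] bounds [2 ^+ l] on all levels, [E * y ^+ 2] the keys per
   level, and [p * ln N] the number of levels below the root. Here [ln N >= 1], valid for large [N],
   absorbs [c_ad] and the summand 1 for the root. *)
pose a := 2 `^ c_ad; pose E := 4 * level_const eta2 2 * (a ^+ 2 + c_geo * a).
pose p := (ln 8)^-1 + c_ad.
exists ((1 + p * E) * (m.+1 ^ 3 * m.+1 ^ 3)%:R).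
near=> N => g _ TS pN qN.
have lnN1 : 1 <= ln N%:R :> R.
  rewrite -[leLHS]expRK ler_ln ?posrE ?expR_gt0 //.
    by near: N; exact: nbhs_infty_ger.
  by rewrite ltr0n; near: N; exact: nbhs_infty_gt.
have N0 : (0 < N)%N by near: N; exact: nbhs_infty_gt.
set y := N%:R `^ (3^-1) in qN *.
have y1 : 1 <= y by rewrite -(powRr0 N%:R) ler_powR ?ler1n.
have -> : N%:R `^ (2 / 3) = y ^+ 2.
  by rewrite -powR_mulrn ?powR_ge0 // -powRrM; congr (_ `^ _); field.
have pminN : (pmin g)%:R <= ln N%:R / ln 8 + c_ad.
  by apply: le_trans pN; rewrite ler_nat geq_min leq_maxl.
have la l : (l <= pmin g)%N -> 2 ^+ l <= a * y.
  move=> lp; apply: pow2_le_root3 => //; by apply: le_trans pminN; rewrite ler_nat.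
have := N_SC_bound_longest _ _ eta2_gt0 _ _ TS qN la.
have -> : 4 * level_const eta2 2 * ((a * y) ^+ 2 + c_geo * y * (a * y)) = E * y ^+ 2.
  by rewrite /E; ring.
move=> SC; rewrite /storage natrM mulrAC ler_wpM2r //.
apply: le_trans SC _.
have l8 : 0 < ln 8 :> R by rewrite ln_gt0 // ltr1n.
have E0 : 0 <= E.
  have L1 := level_const_ge1 _ eta2_gt0 _ (ler0n R 2).
  have a0 : 0 <= a by exact: powR_ge0.
  by apply: mulr_ge0; [lra|rewrite addr_ge0 ?sqr_ge0 ?mulr_ge0].
have y2 : 1 <= y ^+ 2 by rewrite exprn_ege1.
have pl : (pmin g)%:R <= p * ln N%:R.
  by apply: le_trans pminN _; rewrite /p mulrDl [_^-1 * _]mulrC lerD2l ler_peMr.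
have : 1 <= y ^+ 2 * ln N%:R by rewrite mulr_ege1.
have : (pmin g)%:R * (E * y ^+ 2) <= p * ln N%:R * (E * y ^+ 2).
  by rewrite ler_wpM2r // mulr_ge0 //; lra.
lra.
Unshelve. all: by end_near.
Qed.
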